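(* Let $I=[a,b]$ be a compact interval, let $(X,d)$ be a complete metric space, let $g:I\to\mathbb R$ be left-continuous and nondecreasing, let $\alpha>1$, let $F:I\to\mathcal K(X)$ be $g$-Hölder of exponent $\alpha$, and let $p>1$. Fix $\theta\in I$ and $x_\theta\in F(\theta)$, and let $f:I\to X$ be a selection of $F$ with $f(\theta)=x_\theta$ such that, for every $a\le s<t\le b$, $$d(f(s),f(t))\le V_H(F;[s,t])\le[F]_{\alpha,g}|g(t)-g(s)|^\alpha\quad\text{and}\quad V(f;[s,t])\le V_H(F;[s,t]).$$ Then, for every $a\le s<t\le b$, $$\mathcal R_{p,g}(f;[s,t])=\sum_{\substack{\tau\in[s,t)\\ \Delta^+g(\tau)>0}}\frac{J_f(\tau)^p}{[\Delta^+g(\tau)]^{p-1}}\le\mathcal R^H_{p,g}(F;[s,t]).$$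
   Context: $\mathcal K(X)$ is the family of all nonempty compact subsets of $X$ with Hausdorff distance $d_H$. A selection of $F$ is a map $f:I\to X$ with $f(t)\in F(t)$ for all $t\in I$. $F$ is $g$-Hölder of exponent $\alpha$ if there is $L\ge0$ with $d_H(F(s),F(t))\le L|g(t)-g(s)|^\alpha$ for all $s,t\in I$; $[F]_{\alpha,g}$ is the minimum such $L$. $V_H(F;[s,t])=\sup_P\sum_{i=1}^n d_H(F(t_{i-1}),F(t_i))$ and $V(f;[s,t])=\sup_P\sum_{i=1}^n d(f(t_{i-1}),f(t_i))$ over all finite partitions $P:s=t_0<\cdots<t_n=t$. For $\tau\in[a,b)$: $\Delta^+g(\tau)=g(\tau+)-g(\tau)$ with $g(\tau+)=\lim_{r\downarrow\tau}g(r)$; $f(\tau+)=\lim_{r\downarrow\tau}f(r)$ in $X$ (under the stated hypotheses this limit exists for every $\tau\in[a,b)$); $J_f(\tau)=d(f(\tau+),f(\tau))$. For $u:I\to Y$ with $(Y,\rho)$ a metric space, $$\mathcal R_{p,g}(u;[s,t])=\sup_P\sum_{i=1}^n\frac{\rho(u(t_i),u(t_{i-1}))^p}{[g(t_i)-g(t_{i-1})]^{p-1}},$$ the supremum over all finite partitions $P:s=t_0<\cdots<t_n=t$; if $g(t_i)=g(t_{i-1})$, the corresponding term is $0$ when $u(t_i)=u(t_{i-1})$ and $+\infty$ otherwise. $\mathcal R^H_{p,g}(F;[s,t])$ is this quantity for $u=F$, $Y=\mathcal K(X)$, $\rho=d_H$. *)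

(* Defs.v *)
From HB Require Import structures.
From mathcomp Require Import all_boot all_order all_algebra.
From mathcomp Require Import all_classical all_reals all_analysis.

Set Implicit Arguments.
Unset Strict Implicit.
Unset Printing Implicit Defensive.

Import Order.TTheory GRing.Theory Num.Theory.
Import numFieldNormedType.Exports.

Local Open Scope classical_set_scope.
Local Open Scope ring_scope.

(* As the library's [Complete] structure is pointed, such a space is
   nonempty. *)
#[short(type="completeMetricType")]
HB.structure Definition CompleteMetric (R : numDomainType) :=
  {T of Metric R T & Complete T}.

Section hausdorff_distance.
Context {R : realType} {X : metricType R}.
Implicit Types (A B C : set X) (x y z : X).

Definition point_dist x A : R := inf [set mdist x y | y in A].

Definition excess A B : R := sup [set point_dist x B | x in A].

Definition hausdorff_dist A B : R := Num.max (excess A B) (excess B A).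

Lemma point_dist_le x y A : A y -> point_dist x A <= mdist x y.
Proof.
move=> Ay; apply: ge_inf; last by exists y.
by exists 0 => _ [z _ <-]; exact: mdist_ge0.
Qed.

Lemma le_point_dist x A (r : R) : A !=set0 ->
  (forall y, A y -> r <= mdist x y) -> r <= point_dist x A.
Proof.
move=> [y0 Ay0] rA; apply: lb_le_inf; first by exists (mdist x y0), y0.
by move=> _ [y Ay <-]; exact: rA.
Qed.

Lemma point_dist_ge0 x A : A !=set0 -> 0 <= point_dist x A.
Proof. by move=> A0; apply: le_point_dist => // y _; exact: mdist_ge0. Qed.

Lemma point_dist_triangle x y A : A !=set0 ->
  point_dist x A <= mdist x y + point_dist y A.
Proof.
move=> A0; rewrite -lerBlDl; apply: le_point_dist => // z Az.
by rewrite lerBlDl (le_trans (point_dist_le _ Az))// metric_triangle.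
Qed.

Lemma continuous_mdistl y : continuous (fun x => mdist x y : R).
Proof.
move=> x; apply/cvgrPdist_lt => e e0; near=> z.
have xz : mdist x z < e.
  near: z; exact: (metricType_numDomainType.cvgr_dist_lt (f := id) cvg_id).
rewrite (le_lt_trans _ xz)// ler_norml lerBrDr lerBlDr metric_triangle andbT.
rewrite addrC lerBlDr addrC [mdist x z]metric_sym; exact: metric_triangle.
Unshelve. all: by end_near. Qed.

Lemma excess_has_sup A B : A !=set0 -> compact A -> B !=set0 ->
  has_sup [set point_dist x B | x in A].
Proof.
move=> [x Ax] cA [y By]; split; first by exists (point_dist x B), x.
have : compact ((fun z => mdist z y : R) @` A).
  apply: continuous_compact => //; apply: continuous_subspaceT => z.
  exact: continuous_mdistl.
move=> /compact_bounded[M [_ AM]]; exists (M + 1) => _ [z Az <-].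
rewrite (le_trans (point_dist_le z By))//.
rewrite (le_trans (ler_norm _))//; apply: (AM (M + 1)); first by rewrite ltrDl.
by exists z.
Qed.

Lemma point_dist_le_excess x A B : A !=set0 -> compact A -> B !=set0 ->
  A x -> point_dist x B <= excess A B.
Proof.
move=> A0 cA B0 Ax; apply: ub_le_sup; last by exists x.
by case: (excess_has_sup A0 cA B0).
Qed.

Lemma excess_le A B (r : R) : A !=set0 ->
  (forall x, A x -> point_dist x B <= r) -> excess A B <= r.
Proof.
move=> [x Ax] AB; apply: ge_sup; first by exists (point_dist x B), x.
by move=> _ [y Ay <-]; exact: AB.
Qed.

Lemma excess_ge0 A B : A !=set0 -> compact A -> B !=set0 -> 0 <= excess A B.
Proof.
move=> A0 cA B0; have [x Ax] := A0.
by rewrite (le_trans (point_dist_ge0 x B0))// point_dist_le_excess.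
Qed.

Lemma excess_triangle A B C : A !=set0 -> compact A ->
  B !=set0 -> compact B -> C !=set0 -> excess A C <= excess A B + excess B C.
Proof.
move=> A0 cA B0 cB C0; apply: excess_le => // x Ax.
rewrite -lerBlDr (le_trans _ (point_dist_le_excess A0 cA B0 Ax))//.
apply: le_point_dist => // y By; rewrite lerBlDr.
rewrite (le_trans (point_dist_triangle x y C0))// lerD2l.
exact: point_dist_le_excess.
Qed.

Lemma excess_eq0 A B : A !=set0 -> compact A -> B !=set0 -> compact B ->
  excess A B <= 0 -> A `<=` B.
Proof.
move=> A0 cA B0 cB AB x Ax.
have : closed B by apply: compact_closed => //; exact: metric_hausdorff.
apply => U; rewrite -metricType_numDomainType.filter_from_mdist_nbhs.
move=> [e /= e0 xeU]; apply: contrapT => BU.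
have : e <= point_dist x B.
  apply: le_point_dist => // y By; rewrite leNgt; apply/negP => xye.
  by apply: BU; exists y; split => //; exact: xeU.
apply/negP; rewrite -ltNge (le_lt_trans _ e0)//.
by rewrite (le_trans (point_dist_le_excess A0 cA B0 Ax)).
Qed.

Lemma excessxx A : A !=set0 -> compact A -> excess A A = 0.
Proof.
move=> A0 cA; apply/eqP; rewrite eq_le excess_ge0// andbT.
by apply: excess_le => // x Ax; rewrite -(mdistxx x) point_dist_le.
Qed.

End hausdorff_distance.

(* The hyperspace of nonempty compact subsets of [X], made a metric space
   (hence with [mdist]) by the Hausdorff distance. *)
Definition compacts {R : realType} (X : metricType R) : Type :=
  {A : set X | A \in [set A : set X | A !=set0 /\ compact A]}.

HB.instance Definition _ (R : realType) (X : metricType R) :=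
  Choice.on (compacts X).

Definition compacts_set {R : realType} {X : metricType R} (A : compacts X) :
  set X := val A.

Section compacts_metric.
Context {R : realType} {X : metricType R}.
Implicit Types A B C : compacts X.

Definition compacts_dist A B : R :=
  hausdorff_dist (compacts_set A) (compacts_set B).

Let neq0 A : compacts_set A !=set0.
Proof. by have /set_mem[] := valP A. Qed.

Let cpt A : compact (compacts_set A).
Proof. by have /set_mem[] := valP A. Qed.

Let distxx A : compacts_dist A A = 0.
Proof. by rewrite /compacts_dist /hausdorff_dist excessxx// maxxx. Qed.

Let dist_positivity A B : compacts_dist A B = 0 -> A = B.
Proof.
move=> /eqP; rewrite eq_le ge_max => /andP[/andP[AB BA] _].
apply: val_inj; apply/seteqP; split.
  exact: excess_eq0 (neq0 A) (@cpt A) (neq0 B) (@cpt B) AB.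
exact: excess_eq0 (neq0 B) (@cpt B) (neq0 A) (@cpt A) BA.
Qed.

Let dist_sym A B : compacts_dist A B = compacts_dist B A.
Proof. exact: maxC. Qed.

Let dist_triangle B A C :
  compacts_dist A C <= compacts_dist A B + compacts_dist B C.
Proof.
rewrite ge_max; apply/andP; split.
  rewrite (le_trans (excess_triangle _ _ (neq0 B) _ _))//.
  by rewrite lerD// le_max lexx.
rewrite (le_trans (excess_triangle _ _ (neq0 B) _ _))// addrC.
by rewrite lerD// le_max lexx orbT.
Qed.

HB.instance Definition _ := @isMetric.Build R (compacts X) compacts_dist
  distxx dist_positivity dist_sym dist_triangle.

End compacts_metric.

Section partitions.
Context {R : realType}.
Implicit Types (a b s t p alpha : R) (g : R -> R).

(* [s :: l] is the partition s = t_0 < ... < t_n = t; [c x y] is the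
   contribution of the consecutive points x < y. *)
Definition partition_sum (c : R -> R -> \bar R) s t (l : seq R) : \bar R :=
  (\sum_(0 <= i < size l) c (nth t (s :: l) i) (nth t (s :: l) i.+1))%E.

Definition partition_sup (c : R -> R -> \bar R) s t : \bar R :=
  ereal_sup [set partition_sum c s t l | l in itv_partition s t].

Context {Y : metricType R}.
Implicit Types u : R -> Y.

Definition metric_variation u s t : \bar R :=
  partition_sup (fun x y => (mdist (u x) (u y))%:E) s t.

Definition riesz_term p g u (x y : R) : \bar R :=
  if g y == g x then (if u y == u x then 0%E else +oo%E)
  else ((mdist (u y) (u x) `^ p) / ((g y - g x) `^ (p - 1)))%:E.

Definition riesz_variation p g u s t : \bar R :=
  partition_sup (riesz_term p g u) s t.

Definition g_holder_constants alpha g u a b : set R :=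
  [set L | 0 <= L /\ forall s t, s \in `[a, b] -> t \in `[a, b] ->
     mdist (u s) (u t) <= L * `|g t - g s| `^ alpha].

Definition g_holder alpha g u a b : Prop :=
  g_holder_constants alpha g u a b !=set0.

Definition g_holder_seminorm alpha g u a b : R :=
  inf (g_holder_constants alpha g u a b).

Lemma g_holder_seminorm_min alpha g u a b : g_holder alpha g u a b ->
  g_holder_constants alpha g u a b (g_holder_seminorm alpha g u a b) /\
  lbound (g_holder_constants alpha g u a b) (g_holder_seminorm alpha g u a b).
Proof.
move=> H0; have lb0 : lbound (g_holder_constants alpha g u a b) 0.
  by move=> L [].
split; last by apply: ge_inf; exists 0.
split; first exact: lb_le_inf.
move=> s t sab tab; have [d0|d0] := eqVneq (`|g t - g s| `^ alpha) 0.
  by have [L [_ /(_ _ _ sab tab)]] := H0; rewrite d0 !mulr0.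
have dgt0 : 0 < `|g t - g s| `^ alpha by rewrite lt_neqAle eq_sym d0 powR_ge0.
rewrite -ler_pdivrMr//; apply: lb_le_inf => // L [_ HL].
by rewrite ler_pdivrMr// HL.
Qed.

End partitions.

(* A function on [a, b] is given by a total function on R; for tau in [a, b[
   the limit at tau^'+ depends only on its values on [a, b]. *)
Section right_jumps.
Context {R : realType}.

Definition right_jump (g : R -> R) (tau : R) : R :=
  lim (g r @[r --> tau^'+]) - g tau.

Definition right_jumps (g : R -> R) (s t : R) : set R :=
  [set tau | s <= tau < t /\ 0 < right_jump g tau].

Definition metric_jump {X : completeMetricType R} (f : R -> X) (tau : R) : R :=
  mdist (lim (f r @[r --> tau^'+])) (f tau).

End right_jumps.

(* Main.v *)
(* Since alpha > 1, Hölder continuity with respect to g makes f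
   infinitesimally flat: d(f s, f t) <= eta (g t - g s) as soon as g t - g s is
   small. Hence f can only move at the right jumps of g.
   For the upper bound on the Riesz variation of f, u^p / v^(p-1) is the
   supremum over l >= 0 of the linear forms p l^(p-1) u - (p-1) l^p v. For fixed
   l and eps, the inequality
     p l^(p-1) d(f x, f z) - ((p-1) l^p + eps) (g z - g x) <= jump sum on [x, z)
   propagates from z = x by real induction: flatness crosses left limits, and a
   right jump at z adds at most its own term. The jump sum is superadditive, so
   it bounds every partition sum.
   For the lower bounds, refine a partition just to the right of finitely many
   jumps. For F, d(f tau, f r) is bounded by the variation of F on [tau, r],
   which is d_H(F tau, F r) + o(1) as r decreases to tau. *)
Require Import Defs.
From mathcomp Require Import all_boot all_order all_algebra.
From mathcomp Require Import all_classical all_reals all_analysis.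
From mathcomp Require Import ring lra.

Set Implicit Arguments.
Unset Strict Implicit.
Unset Printing Implicit Defensive.

Import Order.TTheory GRing.Theory Num.Theory.
Import numFieldNormedType.Exports.

Local Open Scope classical_set_scope.
Local Open Scope ring_scope.

(** * Real induction, and tangent bounds for powers *)

Section real_line.
Context {R : realType}.

(** Take [c], the supremum of the [z] such that [P] holds on all of [x, z]. The left hypothesis
    gives [P c]; if [c < y], the right one carries [P] past [c], a contradiction. *)
Lemma real_induction (P : R -> Prop) (x y : R) : x <= y ->
  P x ->
  (forall z, x < z <= y -> (forall w, x <= w < z -> P w) -> P z) ->
  (forall z, x <= z < y -> P z -> \forall r \near z^'+, P r) ->
  P y.
Proof.
move=> xy Px Pleft Pright.
pose A := [set z | x <= z <= y /\ forall w, x <= w <= z -> P w].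
have Ax : A x.
  by split => [|w]; [rewrite lexx|move=> xwx; rewrite -(le_anti xwx)].
have supA : has_sup A by split; [exists x | exists y => z [/andP[]]].
set c := sup A.
have xc : x <= c by exact: sup_upper_bound.
have cy : c <= y by apply: ge_sup; [exists x | move=> z [/andP[]]].
have Pltc w : x <= w < c -> P w.
  move=> /andP[xw wc]; have cw0 : 0 < c - w by rewrite subr_gt0.
  have [z [_ Az]] := sup_adherent cw0 supA; rewrite -/c subKr => wz.
  by apply: Az; rewrite xw ltW.
have Pc : P c.
  have [<-//|xc'] := eqVneq x c.
  by apply: Pleft => //; rewrite lt_neqAle xc' xc.
have [<-//|cy'] := eqVneq c y.
have ltcy : c < y by rewrite lt_neqAle cy' cy.
have [|e /= e0 Pe] := Pright c _ Pc; first by rewrite xc.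
have ec : 0 < Num.min (e / 2) (y - c).
  by rewrite lt_min divr_gt0//= subr_gt0.
have : A (c + Num.min (e / 2) (y - c)).
  split => [|w /andP[xw wm]].
    by rewrite (le_trans xc) ?lerDl ?(ltW ec)//= -lerBrDl ge_min lexx orbT.
  have [wc|cw|->//] := ltgtP w c; first by apply: Pltc; rewrite xw.
  apply: Pe => //=; rewrite ltr0_norm ?subr_lt0// opprB ltrBlDl.
  rewrite (le_lt_trans wm)// ltrD2l gt_min; apply/orP; left.
  by rewrite gtr_pMr// invf_lt1 ?ltr1n.
by move/(sup_upper_bound supA); rewrite -/c leNgt ltrDl ec.
Qed.

Lemma near_right_in (tau t : R) (P : R -> Prop) : tau < t ->
  (\forall r \near tau^'+, P r) -> exists2 r, tau < r < t & P r.
Proof.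
move=> taut Pr.
have : \forall r \near tau^'+, tau < r < t /\ P r.
  near=> r; split; last by near: r.
  by apply/andP; split; near: r; [exact: nbhs_right_gt|exact: nbhs_right_lt].
by move=> /filter_ex[r []]; exists r.
Unshelve. all: by end_near. Qed.

Lemma powR_pred (p x : R) : 0 < x -> x `^ p = x * x `^ (p - 1).
Proof.
move=> x0; have := @powRD R x 1 (p - 1).
by rewrite (gt_eqF x0) implybT subrKC powRr1 ?(ltW x0)// => ->.
Qed.

Lemma powR_inv (p x : R) : 0 <= x -> x^-1 `^ p = (x `^ p)^-1.
Proof.
by move=> x0; rewrite -powR_inv1// -powRrM mulN1r -powRN.
Qed.

(* The right-hand side is the perspective [u^p / v^(p-1)] of a convex
   function; the left-hand side is its tangent at [u = l v]. *)
Lemma powR_perspective_ge (p l u v : R) : 1 < p -> 0 <= l -> 0 <= u -> 0 < v ->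
  p * l `^ (p - 1) * u - (p - 1) * l `^ p * v <= u `^ p / v `^ (p - 1).
Proof.
move=> p1 l0 u0 v0; have p0 : 0 < p by apply: lt_trans p1.
have q0 : 0 < p - 1 by rewrite subr_gt0.
have vE := powR_pred p v0.
(* Young's inequality with the conjugate exponents p and p/(p-1); multiplying it by [p * v] gives
   the claim. *)
have := @conjugate_powR R (u / v) (l `^ (p - 1)) p (p / (p - 1)).
rewrite -powRrM mulrCA divff ?gt_eqF// mulr1.
have -> : u / v * l `^ (p - 1) = u * l `^ (p - 1) / v by ring.
rewrite powRM// ?invr_ge0 ?(ltW v0)// => /(_ (divr_ge0 u0 (ltW v0)) (powR_ge0 _ _) p0).
have e : p^-1 + (p / (p - 1))^-1 = 1 by field; rewrite !gt_eqF.
move=> /(_ (divr_gt0 p0 q0) e).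
rewrite -(ler_pM2r (mulr_gt0 p0 v0)).
have -> : u * l `^ (p - 1) / v * (p * v) = p * l `^ (p - 1) * u.
  by field; rewrite gt_eqF.
rewrite powR_inv ?(ltW v0)// vE.
set w := v `^ (p - 1); have w0 : 0 < w by exact: powR_gt0.
have -> : (u `^ p * (v * w)^-1 / p + l `^ p / (p / (p - 1))) * (p * v) =
  u `^ p / w + (p - 1) * l `^ p * v.
  by field; rewrite !gt_eqF.
by rewrite lerBlDr.
Qed.

(** The tangent touches the function at slope [u / v], so a Riesz term is itself one of its linear
    lower bounds. *)
Lemma powR_perspective_eq (p u v : R) : 1 < p -> 0 <= u -> 0 < v ->
  p * (u / v) `^ (p - 1) * u - (p - 1) * (u / v) `^ p * v =
  u `^ p / v `^ (p - 1).
Proof.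
move=> p1 u0 v0; have q0 : 0 < p - 1 by rewrite subr_gt0.
have [->|un0] := eqVneq u 0.
  have p0 : 0 < p by apply: lt_trans p1.
  by rewrite mul0r powR0 ?gt_eqF// powR0 ?gt_eqF// !(mulr0, mul0r) subr0.
have {un0}u0 : 0 < u by rewrite lt_neqAle eq_sym un0.
rewrite !(powR_pred p) ?divr_gt0// powRM ?invr_ge0 ?(ltW u0) ?(ltW v0)//.
rewrite powR_inv ?(ltW v0)//.
by field; rewrite !gt_eqF// powR_gt0.
Qed.

End real_line.

(** * Partition sums and sums over sets of points *)

Section partitions.
Context {R : realType}.
Implicit Types (c m : R -> R -> \bar R) (x y z s t : R).
Local Open Scope ereal_scope.

Lemma partition_sum_nil c s t : partition_sum c s t [::] = 0.
Proof. by rewrite /partition_sum big_nil. Qed.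

Lemma partition_sum_cons c s t x l :
  partition_sum c s t (x :: l) = c s x + partition_sum c x t l.
Proof. by rewrite /partition_sum /= big_nat_recl. Qed.

(** Peel off the first interval and glue it back by superadditivity of [m]; the empty partition is
    covered by [0 <= m x x]. *)
Lemma partition_sum_le c m s t l :
  (forall x y, (s <= x)%R -> (x < y)%R -> (y <= t)%R -> c x y <= m x y) ->
  (forall x, 0 <= m x x) ->
  (forall x y z, (x <= y)%R -> (y <= z)%R -> m x y + m y z <= m x z) ->
  itv_partition s t l -> partition_sum c s t l <= m s t.
Proof.
move=> cm m0 mD; elim: l s cm => [s _ /itv_partition_nil ->|x l IH s cm stl].
  by rewrite partition_sum_nil.
have xtl := itv_partition_cons stl; have xt := itv_partition_le xtl.
have sx : (s < x)%R by case: stl => /= /andP[].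
rewrite partition_sum_cons (le_trans _ (mD s x t (ltW sx) xt))// leeD ?cm//.
by apply: IH => // y z xy; apply: cm; rewrite (le_trans (ltW sx)).
Qed.

Lemma partition_sum_ub c s t l : itv_partition s t l ->
  partition_sum c s t l <= partition_sup c s t.
Proof. by move=> stl; apply: ereal_sup_ubound; exists l. Qed.

Lemma partition_sup_ge0 c s t : (s < t)%R -> 0 <= c s t ->
  0 <= partition_sup c s t.
Proof.
move=> st c0; rewrite (le_trans _ (partition_sum_ub _ (itv_partition1 st)))//.
by rewrite partition_sum_cons partition_sum_nil adde0.
Qed.

(** Prepend [x] to each partition of [x, t]. A real [e] can be moved across the inequality even
    where [c s x] is infinite. *)
Lemma partition_sup_cons c s x t (e : R) : (s < x)%R -> e%:E <= c s x ->
  e%:E + partition_sup c x t <= partition_sup c s t.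
Proof.
move=> sx ec; rewrite -leeBrDl//; apply: ge_ereal_sup => _ [l xtl <-].
rewrite leeBrDl//; have stl : itv_partition s t (x :: l).
  by case: xtl => pl lastl; split => //=; rewrite sx.
by rewrite (le_trans _ (partition_sum_ub _ stl))// partition_sum_cons leeD2r.
Qed.

Lemma partition_sup_anti_left c s x t : (forall r, 0 <= c s r) -> (s <= x)%R ->
  partition_sup c x t <= partition_sup c s t.
Proof.
move=> c0; rewrite le_eqVlt => /predU1P[->//|sx].
by rewrite -[leLHS]add0e partition_sup_cons.
Qed.

(* Sort the points and insert a point shortly after each of them. *)
Lemma sum_right_limits_le_partition_sup c (w : R -> R) (A : set R) s t :
  (forall x y, 0 <= c x y) ->
  (forall tau, A tau -> (s <= tau < t)%R) ->
  (forall tau, A tau -> forall e, (0 < e)%R ->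
     \forall r \near tau^'+, (w tau - e)%:E <= c tau r) ->
  (s < t)%R -> (forall tau, 0 <= w tau)%R ->
  \esum_(tau in A) (w tau)%:E <= partition_sup c s t.
Proof.
move=> c0 Ast near_w st w0.
have sorted_sum l x : path <%R x l -> {in x :: l, forall tau, A tau} ->
    \sum_(tau <- x :: l) (w tau)%:E <= partition_sup c x t.
  elim: l x => [|y l IH] x /= xl xlA.
    rewrite big_seq1; have Ax := xlA x (mem_head _ _).
    have /andP[_ xt] := Ast _ Ax.
    apply/lee_subgt0Pr => e e0.
    have [r /andP[xr rt] wr] := near_right_in xt (near_w _ Ax _ e0).
    rewrite -[leLHS]adde0 (le_trans _ (partition_sup_cons _ xr wr))//.
    by rewrite leeD// partition_sup_ge0.
  have Ax := xlA x (mem_head _ _); have /andP[xy yl] := xl.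
  rewrite big_cons; apply/lee_subgt0Pr => e e0.
  (* The inserted point [r] lies before the next point [y], so the supremum from [r] dominates the
     one from [y]. *)
  have [r /andP[xr ry] wr] := near_right_in xy (near_w _ Ax _ e0).
  rewrite addeAC (le_trans _ (partition_sup_cons _ xr wr))// leeD//.
  rewrite (le_trans (IH y _ _)) ?partition_sup_anti_left ?(ltW ry)//.
  by move=> tau tauyl; apply: xlA; rewrite inE tauyl orbT.
(* An [\esum] is a supremum over finite subsets, so strictly increasing lists of points of [A]
   suffice. *)
apply: ge_ereal_sup => _ [B [finB BA] <-].
rewrite fsbig_finite//=; set l := sort <=%R (finmap.enum_fset (fset_set B)).
rewrite (perm_big l) /=; last by rewrite perm_sym perm_sort.
have lA tau : tau \in l -> A tau.
  by rewrite mem_sort in_fset_set// inE => /BA.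
have : sorted <%R l.
  by rewrite lt_sorted_uniq_le sort_uniq finmap.fset_uniq/= sort_sorted//;
    exact: le_total.
case: l lA => [|x l] lA /= xl.
  by rewrite big_nil partition_sup_ge0.
rewrite (le_trans (sorted_sum _ _ xl lA))// partition_sup_anti_left//.
by have /andP[] := Ast _ (lA _ (mem_head _ _)).
Qed.

(** Serves half-open jump sums: the sum on [x, tau) omits [tau], and going past [tau] collects its
    term. *)
Lemma esum_add_point_le (T : choiceType) (A B : set T) (w : T -> \bar R) tau :
  (forall i, 0 <= w i) -> A `<=` B -> B tau -> ~ A tau ->
  \esum_(i in A) w i + w tau <= \esum_(i in B) w i.
Proof.
move=> w0 AB Btau nAtau; rewrite [leRHS](esumID A)//.
have -> : B `&` A = A by apply/seteqP; split => [i []//|i Ai]; split => //; exact: AB.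
rewrite leeD2l//; apply: esum_ge; exists [set tau]; first by split => // _ ->.
by rewrite fsbig_set1.
Qed.

Lemma le_esum_subset (T : choiceType) (A B : set T) (w : T -> \bar R) :
  (forall i, 0 <= w i) -> A `<=` B ->
  \esum_(i in A) w i <= \esum_(i in B) w i.
Proof.
move=> w0 AB; rewrite [leRHS](esumID A)//.
have -> : B `&` A = A by apply/seteqP; split => [i []//|i Ai]; split => //; exact: AB.
by rewrite leeDl// esum_ge0.
Qed.

End partitions.

(** All that is kept of an exponent above 1. A bound linear in the increment of [g] adds up over
    adjacent intervals. *)
Definition infinitesimally_flat {R : realType} {Y : metricType R}
    (g : R -> R) (u : R -> Y) (a b : R) : Prop :=
  forall eta, 0 < eta -> exists2 delta, 0 < delta &
    forall s t, a <= s -> s <= t -> t <= b -> g t - g s <= delta ->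
      mdist (u s) (u t) <= eta * (g t - g s).

(** * Right limits and jumps of [g] and of flat functions *)

Section right_limits.
Context {R : realType} (a b : R) (g : R -> R).
Hypothesis g_nd : {in `[a, b] &, nondecreasing_fun g}.
Implicit Types (tau r s t : R).

Lemma nd_le s t : a <= s -> s <= t -> t <= b -> g s <= g t.
Proof.
move=> as_ st tb; apply: g_nd => //; rewrite in_itv/= ?as_ ?tb ?andbT//=.
  exact: le_trans tb.
exact: le_trans st.
Qed.

Section at_a_point.
Variable tau : R.
Hypotheses (atau : a <= tau) (taub : tau < b).
Let gp := lim (g r @[r --> tau^'+]).

Lemma right_lim_cvg : g r @[r --> tau^'+] --> gp.
Proof.
suff : cvg (g r @[r --> tau^'+]) by [].
have ltb : (BRight tau < BLeft b)%O by rewrite bnd_simp.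
apply: (cvgP _ (nondecreasing_at_right_cvgr ltb _ _)).
  move=> s t /[!in_itv]/= /andP[taus sb] /andP[taut tb] st.
  by apply: nd_le => //; [rewrite (le_trans atau)// ltW|exact: ltW].
exists (g tau) => _ [t /=/[!in_itv]/= /andP[taut tb] <-].
by apply: nd_le => //; exact: ltW.
Qed.

Lemma right_lim_le r : tau < r -> r <= b -> gp <= g r.
Proof.
move=> taur rb; apply: limr_le; first exact: right_lim_cvg.
near=> w; apply: nd_le => //.
  by rewrite (le_trans atau)// ltW//; near: w; exact: nbhs_right_gt.
by near: w; exact: nbhs_right_le.
Unshelve. all: by end_near. Qed.

Lemma le_right_lim : g tau <= gp.
Proof.
apply: limr_ge; first exact: right_lim_cvg.
near=> w; apply: nd_le => //.
by near: w; exact: nbhs_right_le.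
Unshelve. all: by end_near. Qed.

Lemma right_jumpE : right_jump g tau = gp - g tau. Proof. by []. Qed.

Lemma near_right_lim eta : 0 < eta ->
  \forall r \near tau^'+,
    [/\ tau < r, r <= b, gp <= g r & g r <= gp + eta].
Proof.
move=> eta0; near=> r.
have taur : tau < r by near: r; exact: nbhs_right_gt.
have rb : r <= b by near: r; exact: nbhs_right_le.
split => //; first exact: right_lim_le.
by near: r; apply: cvgr_le right_lim_cvg _ _; rewrite ltrDl.
Unshelve. all: by end_near. Qed.

(** Since [w > tau], the jump at [tau] is left out: [g] grows by at most [g r - gp] from [w] to [r],
    which is as small as flatness requires. *)
Lemma near_flat (Y : metricType R) (u : R -> Y) eta :
  infinitesimally_flat g u a b -> 0 < eta ->
  \forall r \near tau^'+, forall w, tau < w -> w <= r ->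
    mdist (u w) (u r) <= eta * (g r - gp).
Proof.
move=> uflat eta0; have [delta delta0 udelta] := uflat _ eta0.
near=> r => w tauw wr.
have [taur rb gpr gr] : [/\ tau < r, r <= b, gp <= g r & g r <= gp + delta].
  by near: r; exact: near_right_lim.
have gpw := right_lim_le tauw (le_trans wr rb).
rewrite (le_trans (udelta w r _ _ _ _))//.
- by rewrite (le_trans atau)// ltW.
- by lra.
- by rewrite ler_pM2l// lerB.
Unshelve. all: by end_near. Qed.

(** Freeze the slope at [J / D], [D] being the jump of [g]. The tangent there bounds the Riesz term
    from below, and it is linear, so small errors in [J] and [D] cost little. *)
Lemma near_riesz_term (Y : metricType R) (u : R -> Y) (p J e : R) :
  1 < p -> 0 <= J -> 0 < right_jump g tau ->
  (forall eta, 0 < eta ->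
    \forall r \near tau^'+, J - eta <= mdist (u tau) (u r)) -> 0 < e ->
  \forall r \near tau^'+,
    ((J `^ p / right_jump g tau `^ (p - 1) - e)%:E <= riesz_term p g u tau r)%E.
Proof.
move=> p1 J0 D0 Ju e0; set D := right_jump g tau.
rewrite -powR_perspective_eq//; set l := J / D.
have l0 : 0 <= l by rewrite divr_ge0// ltW.
set k := p * l `^ (p - 1); set m := (p - 1) * l `^ p.
have k0 : 0 <= k by rewrite mulr_ge0 ?powR_ge0//; lra.
have m0 : 0 <= m by rewrite mulr_ge0 ?powR_ge0//; lra.
(* Errors of this size in [J] and [D] cost at most [k + m] times it, hence at most [e]; the 1 keeps
   the denominator positive. *)
have eta0 : 0 < e / (k + m + 1) by rewrite divr_gt0//; lra.
near=> r.
have [taur rb gpr gr] :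
    [/\ tau < r, r <= b, gp <= g r & g r <= gp + e / (k + m + 1)].
  by near: r; exact: near_right_lim.
have Jr : J - e / (k + m + 1) <= mdist (u tau) (u r) by near: r; exact: Ju.
have Dr : D <= g r - g tau by rewrite /D right_jumpE lerB.
have gr0 : 0 < g r - g tau by exact: lt_le_trans Dr.
rewrite /riesz_term ifF; last by apply/eqP => grE; move: gr0; rewrite grE subrr ltxx.
rewrite lee_fin (le_trans _ (powR_perspective_ge p1 l0 _ gr0)) ?mdist_ge0//.
rewrite metric_sym -/k -/m; set d := mdist _ _ in Jr *.
have kd : k * (J - e / (k + m + 1)) <= k * d by rewrite ler_wpM2l.
have md : m * (g r - g tau) <= m * (D + e / (k + m + 1)).
  by rewrite ler_wpM2l//; move: gr; rewrite /D right_jumpE; lra.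
have : (k + m) * (e / (k + m + 1)) <= e.
  by rewrite mulrCA ger_pMr// ler_pdivrMr; lra.
by lra.
Unshelve. all: by end_near. Qed.

Context {X : completeMetricType R} (f : R -> X).
Hypothesis f_flat : infinitesimally_flat g f a b.
Let fp := lim (f r @[r --> tau^'+]).

(** Completeness of [X]: by [near_flat], all values on (tau, r] lie in a small ball around [f r]. *)
Lemma flat_right_cvg : f r @[r --> tau^'+] --> fp.
Proof.
suff : cvg (f r @[r --> tau^'+]) by [].
apply: cauchy_cvg; apply: cauchy_exP => e e0.
have : \forall r \near tau^'+, tau < r /\
    forall w, tau < w -> w <= r -> mdist (f w) (f r) < e.
  near=> r.
  have [taur rb gpr gr] :
      [/\ tau < r, r <= b, gp <= g r & g r <= gp + e / 2].
    by near: r; apply: near_right_lim; rewrite divr_gt0.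
  split=> // w tauw wr.
  have fwr : forall w, tau < w -> w <= r -> mdist (f w) (f r) <= 1 * (g r - gp).
    by near: r; exact: near_flat.
  by rewrite (le_lt_trans (fwr w tauw wr))//; lra.
move=> /filter_ex[r [taur fr]]; exists (f r).
rewrite ballEmdist; change (\forall w \near tau^'+, mdist (f r) (f w) < e).
near=> w; rewrite metric_sym; apply: fr.
  by near: w; exact: nbhs_right_gt.
by near: w; exact: nbhs_right_le.
Unshelve. all: by end_near. Qed.

(** Let [w] decrease to [tau] in [near_flat]. *)
Lemma near_flat_lim eta : 0 < eta ->
  \forall r \near tau^'+, mdist fp (f r) <= eta * (g r - gp).
Proof.
move=> eta0; near=> r.
have taur : tau < r by near: r; exact: nbhs_right_gt.
have fr : forall w, tau < w -> w <= r -> mdist (f w) (f r) <= eta * (g r - gp).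
  by near: r; exact: near_flat.
apply/ler_addgt0Pl => e e0.
have [w /andP[tauw wr] fw] := near_right_in taur
  (metricType_numDomainType.cvgr_dist_lt flat_right_cvg e0).
rewrite (le_trans (metric_triangle _ (f w) _))// lerD//; first exact: ltW.
exact/fr/ltW.
Unshelve. all: by end_near. Qed.

Lemma near_metric_jump eta : 0 < eta ->
  \forall r \near tau^'+, metric_jump f tau - eta <= mdist (f tau) (f r).
Proof.
move=> eta0; near=> r.
rewrite lerBlDr (le_trans (metric_triangle _ (f r) _))//.
rewrite addrC [mdist (f r) _]metric_sym lerD2l; near: r.
exact: (metricType_numDomainType.cvgr_dist_le flat_right_cvg).
Unshelve. all: by end_near. Qed.

(** Without a jump of [g], flatness applies on [tau, r] with [tau] included, so [f r] tends to
    [f tau]. *)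
Lemma metric_jump_eq0 : right_jump g tau <= 0 -> metric_jump f tau = 0.
Proof.
rewrite right_jumpE subr_le0 => gpg.
apply/eqP; rewrite eq_le mdist_ge0 andbT; apply/ler_addgt0Pr => e e0.
rewrite add0r; have [delta delta0 fdelta] := f_flat ltr01.
have : \forall r \near tau^'+, metric_jump f tau <= e.
  near=> r.
  have [taur rb gpr gr] :
      [/\ tau < r, r <= b, gp <= g r & g r <= gp + Num.min delta (e / 2)].
    by near: r; apply: near_right_lim; rewrite lt_min delta0 divr_gt0.
  have Jr : metric_jump f tau - e / 2 <= mdist (f tau) (f r).
    by near: r; apply: near_metric_jump; rewrite divr_gt0.
  have [m1 m2] : Num.min delta (e / 2) <= delta /\ Num.min delta (e / 2) <= e / 2.
    by rewrite !ge_min !lexx orbT.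
  have gle := le_right_lim.
  have := fdelta tau r atau (ltW taur) rb.
  by rewrite mul1r => /(_ _); lra.
by move=> /filter_ex[].
Unshelve. all: by end_near. Qed.

End at_a_point.
End right_limits.

(** * Riesz variation of a flat function against its jump sum *)

Section flat_riesz_variation.
Context {R : realType} {X : completeMetricType R} (a b : R) (g : R -> R).
Hypothesis g_nd : {in `[a, b] &, nondecreasing_fun g}.
Context (f : R -> X) (p : R).
Hypothesis f_flat : infinitesimally_flat g f a b.
Hypothesis p1 : 1 < p.

Let term (tau : R) : R :=
  metric_jump f tau `^ p / right_jump g tau `^ (p - 1).

Let term_ge0 tau : (0 <= (term tau)%:E)%E.
Proof. by rewrite lee_fin divr_ge0// powR_ge0. Qed.

Let jump_sum s t := (\esum_(tau in right_jumps g s t) (term tau)%:E)%E.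

Lemma sub_right_jumps s t s' t' : s' <= s -> t <= t' ->
  right_jumps g s t `<=` right_jumps g s' t'.
Proof.
move=> ss tt' tau [/andP[stau taut] D0]; split => //.
by rewrite (le_trans ss stau) (lt_le_trans taut tt').
Qed.

(** The intervals [s, r) and [r, t) are disjoint, so no jump is counted twice. *)
Lemma jump_sum_superadditive s r t : s <= r -> r <= t ->
  (jump_sum s r + jump_sum r t <= jump_sum s t)%E.
Proof.
move=> sr rt; rewrite [leRHS](esumID [set tau | tau < r])//.
rewrite leeD// le_esum_subset// => tau [/andP[stau taut] D0].
  by split => //; split => //; rewrite stau (lt_le_trans taut).
split; last by rewrite /= ltNge stau.
by split => //; rewrite taut (le_trans sr).
Qed.

Hypothesis g_left : forall t, t \in `]a, b] -> g r @[r --> t^'-] --> g t.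

(** The [eps] term is a budget: a flat stretch spends at most [eps] times the increment of [g] over
    it, so the errors never exceed [eps * (g y - g x)]. *)
Lemma tangent_le_jump_sum x y (l eps : R) : a <= x -> x <= y -> y <= b ->
  0 <= l -> 0 < eps ->
  ((p * l `^ (p - 1) * mdist (f x) (f y)
    - ((p - 1) * l `^ p + eps) * (g y - g x))%:E <= jump_sum x y)%E.
Proof.
move=> ax xy yb l0 eps0; set k := p * l `^ (p - 1); set m := (p - 1) * l `^ p.
have k0 : 0 <= k by rewrite mulr_ge0 ?powR_ge0//; have := p1; lra.
have m0 : 0 <= m by rewrite mulr_ge0 ?powR_ge0//; have := p1; lra.
pose eta := eps / (k + 1).
have eta0 : 0 < eta by rewrite divr_gt0//; lra.
have keta : k * eta <= eps by rewrite mulrCA ger_pMr// ler_pdivrMr; lra.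
have kM u v : 0 <= v -> u <= eta * v -> k * u <= eps * v.
  move=> v0 /(ler_wpM2l k0) /le_trans; apply.
  by rewrite mulrA ler_wpM2r.
pose good z := ((k * mdist (f x) (f z) - (m + eps) * (g z - g x))%:E
  <= jump_sum x z)%E.
apply: (@real_induction R good x y) => //.
- by rewrite /good mdistxx subrr !mulr0 subrr esum_ge0.
- move=> z /andP[xz zy] goodw.
  have [delta delta0 fdelta] := f_flat eta0.
  have zab : z \in `]a, b].
    by rewrite in_itv/= (le_lt_trans ax xz) (le_trans zy yb).
  have : \forall w \near z^'-, [/\ x <= w, w < z & g z - g w <= delta].
    near=> w; split; [by near: w; exact: nbhs_left_ge
      |by near: w; exact: nbhs_left_lt|].
    rewrite lerBlDr -lerBlDl; near: w.
    (* Left-continuity of [g] provides a [w] from which flatness reaches [z]. *)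
    by apply: cvgr_ge (g_left zab) _ _; rewrite ltrBlDr ltrDl.
  move=> /filter_ex[w [xw wz gzw]].
  have aw := le_trans ax xw; have zb := le_trans zy yb.
  have fwz := fdelta w z aw (ltW wz) zb gzw.
  have gwz := nd_le g_nd aw (ltW wz) zb.
  apply: (@le_trans _ _ (jump_sum x w)); last first.
    by apply: le_esum_subset => //; apply: sub_right_jumps => //; exact: ltW.
  apply: le_trans (goodw w _); last by rewrite xw.
  rewrite lee_fin.
  have gwz0 : 0 <= g z - g w by rewrite subr_ge0.
  have kwz := kM _ _ gwz0 fwz.
  have kt : k * mdist (f x) (f z) <= k * mdist (f x) (f w) + k * mdist (f w) (f z).
    by rewrite -mulrDr ler_wpM2l ?metric_triangle.
  have mwz : 0 <= m * (g z - g w) by rewrite mulr_ge0.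
  by lra.
- move=> z /andP[xz zy] goodz.
  have az := le_trans ax xz; have zb := lt_le_trans zy yb.
  near=> r.
  have [zr rb gpr _] : [/\ z < r, r <= b, lim (g r @[r --> z^'+]) <= g r
      & g r <= lim (g r @[r --> z^'+]) + 1].
    by near: r; apply: (near_right_lim g_nd).
  have fr : mdist (lim (f r @[r --> z^'+])) (f r)
      <= eta * (g r - lim (g r @[r --> z^'+])).
    by near: r; apply: (near_flat_lim g_nd).
  have ggp := le_right_lim g_nd az zb.
  set J := metric_jump f z; set D := right_jump g z.
  have DE : D = lim (g r @[r --> z^'+]) - g z by [].
  (* Go from [z] to [r] through the right limits: first the jumps [J] and [D], then a flat stretch
     paid by the budget. *)
  have step : k * mdist (f x) (f r) - (m + eps) * (g r - g x) <=
      (k * mdist (f x) (f z) - (m + eps) * (g z - g x)) + (k * J - m * D).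
    move: DE fr gpr ggp; set gp := lim (g r @[r --> _]).
    set fp := lim (f r @[r --> _]) => DE fr gpr ggp.
    have gpr0 : 0 <= g r - gp by rewrite subr_ge0.
    have kr := kM _ _ gpr0 fr.
    have kt : k * mdist (f x) (f r) <=
        k * mdist (f x) (f z) + (k * J + k * mdist fp (f r)).
      rewrite -!mulrDr ler_wpM2l// (le_trans (metric_triangle _ (f z) _))//.
      by rewrite lerD2l (le_trans (metric_triangle _ fp _))// [mdist (f z) _]metric_sym.
    have mr : 0 <= m * (g r - gp) by rewrite mulr_ge0.
    have D0 : 0 <= eps * D by rewrite mulr_ge0 ?(ltW eps0)// DE subr_ge0.
    by move: D0; rewrite DE; lra.
  apply: le_trans (_ : (_ <= (k * mdist (f x) (f z)
    - (m + eps) * (g z - g x))%:E + (k * J - m * D)%:E)%E) _.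
    by rewrite -EFinD lee_fin.
  (* At a jump of [g], the tangent bound turns [k * J - m * D] into the term of [z]; otherwise [J]
     and [D] both vanish. *)
  have [D0|D0] := ltP 0 D.
    apply: (@le_trans _ _ (jump_sum x z + (term z)%:E)%E).
      by rewrite leeD// lee_fin powR_perspective_ge// mdist_ge0.
    apply: esum_add_point_le => //.
    + by apply: sub_right_jumps => //; exact: ltW.
    + by split => //; rewrite xz.
    + by move=> [/andP[_]]; rewrite ltxx.
  have J0 : J = 0 by exact: (metric_jump_eq0 g_nd az zb f_flat).
  have D00 : D = 0 by apply/le_anti; rewrite D0 DE subr_ge0.
  rewrite J0 D00 !mulr0 subrr adde0 (le_trans goodz)//.
  by apply: le_esum_subset => //; apply: sub_right_jumps => //; exact: ltW.
Unshelve. all: by end_near. Qed.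

Lemma riesz_term_le_jump_sum x y : a <= x -> x < y -> y <= b ->
  (riesz_term p g f x y <= jump_sum x y)%E.
Proof.
move=> ax xy yb; rewrite /riesz_term; case: ifPn => [/eqP gxy|gxy].
  (* Equal values of [g] force equal values of [f], which rules out the infinite branch. *)
  have [delta delta0 fdelta] := f_flat ltr01.
  have := fdelta x y ax (ltW xy) yb.
  rewrite gxy subrr mulr0 (ltW delta0) => /(_ isT) fxy.
  suff -> : f y = f x by rewrite eqxx esum_ge0.
  by apply/esym/mdist_positivity/le_anti; rewrite fxy mdist_ge0.
have gxy0 : 0 < g y - g x.
  by rewrite subr_gt0 lt_neqAle eq_sym gxy (nd_le g_nd)// ltW.
rewrite -(powR_perspective_eq p1 (mdist_ge0 _ _) gxy0).
set l := mdist _ _ / (g y - g x); have l0 : 0 <= l by rewrite divr_ge0 ?mdist_ge0// ltW.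
apply/lee_subgt0Pr => e e0.
(* With [l] the slope of the chord, the tangent equals the Riesz term; this [eps] makes the whole
   budget equal to [e]. *)
have eps0 : 0 < e / (g y - g x) by rewrite divr_gt0.
apply: le_trans (tangent_le_jump_sum ax (ltW xy) yb l0 eps0).
rewrite -EFinB lee_fin [mdist (f y) _]metric_sym [in leRHS]mulrDl divfK ?gt_eqF//.
by rewrite opprD addrA.
Qed.

Lemma riesz_variation_le_jump_sum s t : a <= s -> s < t -> t <= b ->
  (riesz_variation p g f s t <= jump_sum s t)%E.
Proof.
move=> as_ st tb; apply: ge_ereal_sup => _ [l stl <-].
apply: partition_sum_le => //.
- move=> x y sx xy yt.
  by apply: riesz_term_le_jump_sum => //; [exact: le_trans sx|exact: le_trans tb].
- by move=> x; exact: esum_ge0.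
- exact: jump_sum_superadditive.
Qed.

Lemma riesz_term_ge0 (Y : metricType R) (u : R -> Y) x y :
  (0 <= riesz_term p g u x y)%E.
Proof.
rewrite /riesz_term; case: ifP => _; first by case: ifP.
by rewrite lee_fin divr_ge0 ?powR_ge0.
Qed.

(** The function [u] need only move at least as much as [f] jumps, so that both [f] and [F]
    qualify. *)
Lemma jump_sum_le_riesz_variation (Y : metricType R) (u : R -> Y) s t :
  a <= s -> s < t -> t <= b ->
  (forall tau, a <= tau -> tau < b -> forall eta, 0 < eta ->
    \forall r \near tau^'+, metric_jump f tau - eta <= mdist (u tau) (u r)) ->
  (jump_sum s t <= riesz_variation p g u s t)%E.
Proof.
move=> as_ st tb uJ; apply: sum_right_limits_le_partition_sup => //.
- by move=> x y; exact: riesz_term_ge0.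
- by move=> tau [].
move=> tau [/andP[stau taut] D0] e e0.
have atau := le_trans as_ stau; have taub := lt_le_trans taut tb.
by apply: (near_riesz_term g_nd atau taub) => //; [exact: mdist_ge0|exact: uJ].
Qed.

End flat_riesz_variation.

(** Write x^alpha as x times x^(alpha-1); [delta] makes the second factor at most [eta / (L + 1)],
    where [L + 1] avoids dividing by 0. *)
Lemma powR_le_linear {R : realType} (alpha L eta : R) :
  1 < alpha -> 0 <= L -> 0 < eta ->
  exists2 delta, 0 < delta &
    forall x, 0 <= x -> x <= delta -> L * x `^ alpha <= eta * x.
Proof.
move=> alpha1 L0 eta0; have q0 : 0 < alpha - 1 by rewrite subr_gt0.
have c0 : 0 < eta / (L + 1) by rewrite divr_gt0//; lra.
exists ((eta / (L + 1)) `^ (alpha - 1)^-1); first exact: powR_gt0.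
move=> x; rewrite le_eqVlt => /predU1P[<- _|x0 xd].
  by rewrite powR0 ?mulr0// gt_eqF//; lra.
have xq : x `^ (alpha - 1) <= eta / (L + 1).
  have := ge0_ler_powR (ltW q0) _ _ xd.
  rewrite !nnegrE (ltW x0) powR_ge0 => /(_ isT isT) /le_trans; apply.
  by rewrite -powRrM mulVf ?gt_eqF// powRr1// ltW.
rewrite powR_pred// mulrCA mulrC ler_pM2r//.
rewrite (le_trans (ler_wpM2l L0 xq))// mulrCA ger_pMr// ler_pdivrMr; lra.
Qed.

(** * Variation just to the right of a point *)

Section variation.
Context {R : realType} {Y : metricType R} (a b : R) (g : R -> R) (u : R -> Y).
Hypothesis g_nd : {in `[a, b] &, nondecreasing_fun g}.
Hypothesis u_flat : forall eta, 0 < eta -> exists2 delta, 0 < delta &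
  forall s t, a <= s -> s < t -> t <= b -> g t - g s <= delta ->
    (metric_variation u s t <= (eta * (g t - g s))%:E)%E.

(** Only the first interval [tau, x] of a partition meets the jump. The rest has variation at most
    [eta / 2], and replacing [u x] by [u r] costs another [eta / 2]. *)
Lemma near_metric_variation tau eta : a <= tau -> tau < b -> 0 < eta ->
  \forall r \near tau^'+,
    (metric_variation u tau r <= (mdist (u tau) (u r) + eta)%:E)%E.
Proof.
move=> atau taub eta0; have [delta delta0 udelta] := u_flat ltr01.
set gp := lim (g r @[r --> tau^'+]).
near=> r.
have [taur rb gpr gr] :
    [/\ tau < r, r <= b, gp <= g r & g r <= gp + Num.min delta (eta / 2)].
  by near: r; apply: (near_right_lim g_nd) => //; rewrite lt_min delta0 divr_gt0.
have [m1 m2] : Num.min delta (eta / 2) <= delta /\ Num.min delta (eta / 2) <= eta / 2.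
  by rewrite !ge_min !lexx orbT.
have var_r x : tau < x -> x < r ->
    (metric_variation u x r <= (eta / 2)%:E)%E.
  move=> taux xr; have gpx := right_lim_le g_nd atau taub taux (le_trans (ltW xr) rb).
  apply: (le_trans (udelta x r _ xr rb _)).
  - by rewrite (le_trans atau)// ltW.
  - by rewrite -/gp in gpx; lra.
  - by rewrite lee_fin mul1r; rewrite -/gp in gpx; lra.
apply: ge_ereal_sup => _ [[|x l] taurl <-].
  by have := itv_partition_nil taurl => taurE; rewrite taurE ltxx in taur.
have taux : tau < x by case: taurl => /= /andP[].
have xrl := itv_partition_cons taurl.
have := itv_partition_le xrl; rewrite partition_sum_cons le_eqVlt.
move=> /predU1P[xr|xr].
  move: xrl; rewrite xr => /itv_partitionxx ->.
  by rewrite partition_sum_nil adde0 lee_fin lerDl ltW.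
have xrV := partition_sum_ub (fun x y => (mdist (u x) (u y))%:E) xrl.
have xr1 : ((mdist (u x) (u r))%:E <= (eta / 2)%:E)%E.
  apply: le_trans (var_r x taux xr).
  have := partition_sum_ub (fun x y => (mdist (u x) (u y))%:E) (itv_partition1 xr).
  by rewrite partition_sum_cons partition_sum_nil adde0.
apply: le_trans (leeD (lexx _) (le_trans xrV (var_r x taux xr))) _.
rewrite -EFinD lee_fin; move: xr1; rewrite lee_fin => xr1.
have := metric_triangle (u tau) (u r) (u x).
by rewrite [mdist (u r) _]metric_sym; lra.
Unshelve. all: by end_near. Qed.

End variation.

(** * The jump formula for the selection and the comparison with [F] *)

Theorem corollary9p8 (R : realType) (X : completeMetricType R)
    (a b : R) (hab : a <= b)
    (g : R -> R)
    (g_left : forall t, t \in `]a, b] -> g r @[r --> t^'-] --> g t)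
    (g_nd : {in `[a, b] &, nondecreasing_fun g})
    (alpha : R) (alpha1 : 1 < alpha)
    (F : R -> compacts X) (F_holder : g_holder alpha g F a b)
    (p : R) (p1 : 1 < p)
    (theta : R) (theta_ab : theta \in `[a, b])
    (x_theta : X) (x_theta_F : compacts_set (F theta) x_theta)
    (f : R -> X)
    (f_sel : forall t, t \in `[a, b] -> compacts_set (F t) (f t))
    (f_theta : f theta = x_theta)
    (f_dist : forall s t, a <= s -> s < t -> t <= b ->
       ((mdist (f s) (f t))%:E <= metric_variation F s t)%E /\
       (metric_variation F s t <=
          (g_holder_seminorm alpha g F a b * `|g t - g s| `^ alpha)%:E)%E)
    (f_var : forall s t, a <= s -> s < t -> t <= b ->
       (metric_variation f s t <= metric_variation F s t)%E) :
  forall s t, a <= s -> s < t -> t <= b ->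
    riesz_variation p g f s t =
      \esum_(tau in right_jumps g s t)
        (metric_jump f tau `^ p / right_jump g tau `^ (p - 1))%:E /\
    (\esum_(tau in right_jumps g s t)
        (metric_jump f tau `^ p / right_jump g tau `^ (p - 1))%:E
      <= riesz_variation p g F s t)%E.
Proof.
move=> s t as_ st tb.
have [[L0 _] _] := g_holder_seminorm_min F_holder.
have F_flat eta : 0 < eta -> exists2 delta, 0 < delta &
    forall s t, a <= s -> s < t -> t <= b -> g t - g s <= delta ->
      (metric_variation F s t <= (eta * (g t - g s))%:E)%E.
  move=> eta0; have [delta delta0 Ldelta] := powR_le_linear alpha1 L0 eta0.
  exists delta => // x y ax xy yb gxy.
  have gxy0 : 0 <= g y - g x by rewrite subr_ge0 (nd_le g_nd)// ltW.
  have [_ /le_trans] := f_dist x y ax xy yb; apply.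
  by rewrite lee_fin ger0_norm// Ldelta.
have f_flat : infinitesimally_flat g f a b.
  move=> eta eta0; have [delta delta0 Fdelta] := F_flat _ eta0.
  exists delta => // x y ax; rewrite le_eqVlt => /predU1P[<- _ _|xy yb gxy].
    by rewrite mdistxx subrr mulr0.
  rewrite -lee_fin; have [fF _] := f_dist x y ax xy yb.
  exact: le_trans fF (Fdelta x y ax xy yb gxy).
split.
  apply/eqP; rewrite eq_le; apply/andP; split.
    exact: (riesz_variation_le_jump_sum g_nd).
  apply: (jump_sum_le_riesz_variation g_nd) => // tau atau taub eta eta0.
  exact: (near_metric_jump g_nd).
apply: (jump_sum_le_riesz_variation g_nd) => // tau atau taub eta eta0.
have eta20 : 0 < eta / 2 by rewrite divr_gt0.
near=> r.
have taur : tau < r by near: r; exact: nbhs_right_gt.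
have rb : r <= b by near: r; exact: nbhs_right_le.
have Jr : metric_jump f tau - eta / 2 <= mdist (f tau) (f r).
  by near: r; exact: (near_metric_jump g_nd).
(* Half of [eta] pays for the right limit of [f], half for replacing the variation of [F] by a
   single distance. *)
have VF : (metric_variation F tau r <= (mdist (F tau) (F r) + eta / 2)%:E)%E.
  by near: r; exact: (near_metric_variation g_nd).
have [fF _] := f_dist tau r atau taur rb.
have := le_trans fF VF; rewrite lee_fin.
by lra.
Unshelve. all: by end_near. Qed.
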